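(* There exist a metric space $(X,d)$ without isolated points and a non-autonomous dynamical system $f_{1,\infty}=\{f_n\}_{n=1}^{\infty}$ on $X$ (a sequence of continuous self-maps of $X$) such that all of the following hold: (i) $(X,f_{1,\infty})$ is finitely generated; (ii) $(X,f_{1,\infty})$ is not periodic; (iii) $(X,f_{1,\infty})$ is topologically transitive; (iv) $\overline{\mathrm{Per}(f_{1,\infty})}=X$; (v) there exist two invariant periodic points $x,y\in X$ of $f_{1,\infty}$ such that $\mathrm{orb}(x,f_{1,\infty})\cap \mathrm{orb}(y,f_{1,\infty})=\emptyset$.
   Context: Notation: $\mathbb{N}=\{1,2,3,\ldots\}$, $\mathbb{Z}^{+}=\{0,1,2,\ldots\}$. A non-autonomous dynamical system (NADS) $(X,f_{1,\infty})$ on a metric space $(X,d)$ is a sequence $f_{1,\infty}=\{f_n\}_{n=1}^{\infty}$ of continuous maps $f_n:X\to X$. Put $f_1^{(0)}=\mathrm{id}_X$ and $f_1^{(n)}=f_n\circ f_{n-1}\circ\cdots\circ f_1$ for $n\in\mathbb{N}$. The orbit of $x\in X$ is $\mathrm{orb}(x,f_{1,\infty})=\{f_1^{(n)}(x): n\in\mathbb{Z}^+\}$. The NADS is: - topologically transitive if for every pair of nonempty open subsets $U,V$ of $X$ there exists $n\in\mathbb{Z}^+$ such that $f_1^{(n)}(U)\cap V\neq\emptyset$; - finitely generated if $\{f_i: i\in\mathbb{N}\}$ is a finite set of maps; - periodic if there exists $k\in\mathbb{N}$ such that $f_{n+k}=f_n$ for all $n\in\mathbb{N}$. A point $x\in X$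 is a periodic point of $f_{1,\infty}$ if there exists $n\in\mathbb{N}$ such that $f_1^{(nk)}(x)=x$ for all $k\in\mathbb{Z}^+$; $\mathrm{Per}(f_{1,\infty})$ is the set of all periodic points. A subset $A\subset X$ is invariant for $f_{1,\infty}$ if $f_i(A)\subset A$ for every $i\in\mathbb{N}$. A point $x$ is an invariant periodic point of $f_{1,\infty}$ if $x\in\mathrm{Per}(f_{1,\infty})$ and $\mathrm{orb}(x,f_{1,\infty})$ is an invariant set for $f_{1,\infty}$. *)

(* Defs.v *)
From HB Require Import structures.
From mathcomp Require Import all_boot all_order all_algebra.
From mathcomp Require Import all_classical all_reals all_analysis.

Set Implicit Arguments.
Unset Strict Implicit.
Unset Printing Implicit Defensive.

Local Open Scope classical_set_scope.

(* A sequence f_1, f_2, ... of self-maps is represented by f : nat -> T -> T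
   with f n standing for f_{n+1}, so that every value of f is one of the maps
   of the system. *)

Section NADS.
Variables (T : Type) (f : nat -> T -> T).

(* f_n \o ... \o f_1, the n-fold composition from time 0 (the identity at n = 0) *)
Fixpoint nads_comp (n : nat) : T -> T :=
  if n is m.+1 then f m \o nads_comp m else id.

Definition nads_orb (x : T) : set T := [set nads_comp n x | n in [set: nat]].

Definition nads_finitely_generated : Prop := finite_set (range f).

Definition nads_periodic : Prop :=
  exists k : nat, (0 < k)%N /\ forall n : nat, f (n + k)%N = f n.

Definition nads_Per : set T :=
  [set x | exists n : nat,
     (0 < n)%N /\ forall k : nat, nads_comp (n * k)%N x = x].

Definition nads_invariant (A : set T) : Prop :=
  forall i : nat, f i @` A `<=` A.

Definition nads_invariant_periodic (x : T) : Prop :=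
  nads_Per x /\ nads_invariant (nads_orb x).

End NADS.

Definition nads_transitive (T : topologicalType) (f : nat -> T -> T) : Prop :=
  forall U V : set T, open U -> open V -> U !=set0 -> V !=set0 ->
    exists n : nat, (nads_comp f n @` U) `&` V !=set0.

(* Main.v *)
Require Import Defs.
From HB Require Import structures.
From mathcomp Require Import all_boot all_order all_algebra.
From mathcomp Require Import all_classical all_reals all_analysis.

(** The witness lives on the Cantor space of bit streams.  Its shift is
    transitive and has dense periodic points, but running it at every time
    step gives a periodic system.  The system used here runs, in the very
    first step only, the map that shifts and then negates the leading bit, and
    the shift in all later steps.  The second step deletes the leading bit, so
    the altered bit is visible only at time 1: [nads_comp_first_step] says
    that at all other times the composition is an iterate of the shift.  Hence
    transitivity and the density of the periodic points are inherited from the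
    shift ([nads_transitive_system], [dense_Per_system]), while the system
    cannot be periodic, since its first map never occurs again.

    Each constant stream is an invariant periodic point
    ([cst_invariant_periodic]): its orbit consists of itself and of the stream
    with the leading bit negated, a pair that both maps preserve.  Beyond
    the leading bit all points of such an orbit agree with the constant, so
    the orbits of the two constant streams are disjoint. *)

Set Implicit Arguments.
Unset Strict Implicit.
Unset Printing Implicit Defensive.

Import Order.TTheory GRing.Theory Num.Theory.

Local Open Scope classical_set_scope.

(** * Systems that differ from an autonomous one in the first step *)

Definition first_step (T : Type) (g s : T -> T) (n : nat) : T -> T :=
  if n is 0%N then g else s.

(** If [s] cannot tell [g] from [s], the change in the first step is forgotten
    at time 2, and at time 0 no map has been applied yet. *)
Lemma nads_comp_first_step (T : Type) (g s : T -> T) :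
    (forall x, s (g x) = s (s x)) ->
  forall n x, n != 1%N -> nads_comp (first_step g s) n x = iter n s x.
Proof.
move=> sg [//|[//|n]] x _.
by elim: n => [|n IHn]; [exact: sg | rewrite iterS -IHn].
Qed.

(** * The Cantor space as a metric space *)

(** The field of scalars is a parameter because the metric structure is
    attached to the type together with the field in which distances live. *)
Definition stream (R : realType) : Type := nat -> bool.

HB.instance Definition _ (R : realType) :=
  Choice.copy (stream R) (nat -> bool).

Section Distance.
Local Open Scope ring_scope.
Variable R : realType.
Implicit Types x y z : stream R.

(** The inverse of the (one-based) position of the first disagreement. *)
Definition stream_dist x y : R :=
  if pselect (exists n, x n != y n) is left xy then (ex_minn xy).+1%:R^-1
  else 0.

(** This characterization makes the metric axioms formal: a bound on the
    distance says exactly on which coordinates two streams agree. *)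
Lemma stream_dist_le x y (e : R) : 0 <= e ->
  stream_dist x y <= e <-> forall n, e < n.+1%:R^-1 -> x n = y n.
Proof.
move=> e0; rewrite /stream_dist; case: pselect => [xy|nxy]; last first.
  split=> // _ n _; apply/eqP/negPn/negP => xyn.
  by apply: nxy; exists n.
case: ex_minnP => m xym m_min; split=> [me n en|agree].
  apply/eqP/negPn/negP => /m_min mn.
  have := lt_le_trans (le_lt_trans me en); move=> /(_ m.+1%:R^-1).
  by rewrite lef_pV2 ?posrE ?ltr0n// ler_nat ltnS mn ltxx => /(_ isT).
by rewrite leNgt; apply/negP => /agree xym'; rewrite xym' eqxx in xym.
Qed.

Lemma stream_dist_ge0 x y : 0 <= stream_dist x y.
Proof. by rewrite /stream_dist; case: pselect => // xy; rewrite invr_ge0. Qed.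

Lemma stream_distxx x : stream_dist x x = 0.
Proof.
by apply/eqP; rewrite eq_le stream_dist_ge0 andbT; apply/stream_dist_le.
Qed.

Lemma stream_dist_positivity x y : stream_dist x y = 0 -> x = y.
Proof.
move=> d0; apply/funext => n.
have /stream_dist_le : stream_dist x y <= 0 by rewrite d0.
by apply=> //; rewrite invr_gt0 ltr0n.
Qed.

Lemma stream_dist_sym x y : stream_dist x y = stream_dist y x.
Proof.
suff le_sym u v : stream_dist u v <= stream_dist v u.
  by apply/eqP; rewrite eq_le !le_sym.
apply/stream_dist_le => [|n lt_n]; first exact: stream_dist_ge0.
apply/esym; move: n lt_n; apply/stream_dist_le => //.
exact: stream_dist_ge0.
Qed.

Lemma stream_dist_triangle y x z :
  stream_dist x z <= stream_dist x y + stream_dist y z.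
Proof.
have d0 := stream_dist_ge0.
have agree u v n : stream_dist u v < n.+1%:R^-1 -> u n = v n.
  by move: n; apply/stream_dist_le.
apply/stream_dist_le => [|n lt_n]; first exact: addr_ge0.
by rewrite (agree x y) ?(agree y z)//; apply: le_lt_trans lt_n;
  rewrite ?lerDl ?lerDr.
Qed.

HB.instance Definition _ := isMetric.Build R (stream R)
  stream_distxx stream_dist_positivity stream_dist_sym stream_dist_triangle.

(** All topological arguments below go through this description of
    neighbourhoods by cylinders instead of distances. *)
Lemma nbhs_streamP x (A : set (stream R)) :
  nbhs x A <-> exists m, forall y, (forall i, (i < m)%N -> x i = y i) -> A y.
Proof.
split=> [/nbhs_ballP[e /= e0 eA]|[m mA]].
  have [m me] : exists m, m.+1%:R^-1 < e.
    exists (Num.bound e^-1); rewrite invf_plt ?posrE ?ltr0n//.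
    apply: lt_trans (archi_boundP _) _; first by rewrite invr_ge0 ltW.
    by rewrite ltr_nat.
  exists m => y xy; apply: eA; rewrite ballEmdist /=.
  apply: le_lt_trans me; apply/stream_dist_le => [|n].
    by rewrite invr_ge0.
  by rewrite ltf_pV2 ?posrE ?ltr0n// ltr_nat ltnS => /xy.
apply/nbhs_ballP; exists m.+1%:R^-1 => /=; first by rewrite invr_gt0 ltr0n.
move=> y; rewrite ballEmdist /= => xy; apply: mA => i im.
have /stream_dist_le := lexx (stream_dist x y).
apply; first exact: stream_dist_ge0.
apply: lt_trans xy _.
by rewrite ltf_pV2 ?posrE ?ltr0n// ltr_nat ltnS.
Qed.

End Distance.

Lemma isolated_stream (R : realType) : isolated [set: stream R] = set0.
Proof.
apply/seteqP; split=> // x [_ [V /nbhs_streamP[m mV]]]; rewrite setIT => Vx.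
pose y : stream R := fun n => if n == m then ~~ x n else x n.
have : V y by apply: mV => i im; rewrite /y ltn_eqF.
by rewrite Vx => /(congr1 (@^~ m)); rewrite /y eqxx; case: (x m).
Qed.

(** * The shift and its altered version *)

Section Shift.
Variable R : realType.
Implicit Types x y : stream R.

Definition shift x : stream R := fun n => x n.+1.

Definition negate_head x : stream R :=
  fun n => if n is 0%N then ~~ x 0%N else x n.

Definition system : nat -> stream R -> stream R :=
  first_step (negate_head \o shift) shift.

Lemma iter_shift n x i : iter n shift x i = x (n + i)%N.
Proof. by elim: n i => //= n IHn i; rewrite /shift IHn addnS addSn. Qed.

Lemma nads_comp_system n x : n != 1%N ->
  nads_comp system n x = iter n shift x.
Proof. by apply: nads_comp_first_step. Qed.

Lemma continuous_stream (f : stream R -> stream R) :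
    (forall m x y, (forall i, (i < m.+1)%N -> x i = y i) ->
      forall i, (i < m)%N -> f x i = f y i) ->
  continuous f.
Proof.
move=> fP x A /nbhs_streamP[m mA]; apply/nbhs_streamP; exists m.+1 => y xy.
by apply: mA; exact: fP.
Qed.

Lemma continuous_system n : continuous (system n).
Proof.
apply: continuous_stream => m x y xy i im.
by case: n => [|n]; case: i im => [|i] im; rewrite /= /shift /= xy.
Qed.

Lemma finitely_generated_system : nads_finitely_generated system.
Proof.
apply: (@sub_finite_set _ _ [set negate_head \o shift; shift]) => //.
by move=> _ [[|n] _ <-]; [left | right].
Qed.

(** Only the first map moves the zero stream. *)
Lemma not_periodic_system : ~ nads_periodic system.
Proof.
by move=> [[|k] [// _ /(_ 0%N)]] /(congr1 (fun f => f (fun=> false) 0%N)).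
Qed.

(** A stream that starts like a point of [U] and goes on with a point of [V]
    reaches the latter once the starting segment has been shifted away. *)
Lemma nads_transitive_system : nads_transitive system.
Proof.
move=> U V oU _ [x Ux] [y Vy].
have /nbhs_streamP[m mU] : nbhs x U by exact: open_nbhs_nbhs.
(* The offset 2 keeps the time of arrival away from 1. *)
exists m.+2, y; split=> //.
exists (fun i => if (i < m.+2)%N then x i else y (i - m.+2)%N).
  by apply: mU => i im; rewrite ltnW// ltnW.
rewrite nads_comp_system//; apply/funext => i.
by rewrite iter_shift ltnNge leq_addr addKn.
Qed.

(** Repeating an initial segment of length [m.+1] gives a periodic point in
    the corresponding cylinder. *)
Lemma dense_Per_system : closure (nads_Per system) = [set: stream R].
Proof.
apply/seteqP; split=> // x _ A /nbhs_streamP[m mA].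
exists (fun i => x (i %% m.+1)%N); split; last first.
  by apply: mA => i im; rewrite modn_small// ltnW.
(* The period is doubled so that none of its multiples is 1. *)
exists (2 * m.+1)%N; split=> // k; rewrite nads_comp_system; last first.
  by rewrite -mulnA; apply/eqP => /(congr1 odd); rewrite oddM.
by apply/funext => i; rewrite iter_shift mulnAC modnMDl.
Qed.

Lemma iter_shift_cst n (b : bool) : iter n shift (fun=> b) = (fun=> b).
Proof. by apply/funext => i; rewrite iter_shift. Qed.

Lemma nads_orb_cst (b : bool) :
  nads_orb system (fun=> b) = [set (fun=> b); negate_head (fun=> b)].
Proof.
apply/seteqP; split=> [_ [n _ <-]|_ [->|->]].
- have [->|n1] := eqVneq n 1%N; first by right.
  by left; rewrite nads_comp_system// iter_shift_cst.
- by exists 0%N.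
- by exists 1%N.
Qed.

(** Shifting either point of the orbit gives the constant stream, and the
    altered first step then negates its head. *)
Lemma cst_invariant_periodic (b : bool) :
  nads_invariant_periodic system (fun=> b).
Proof.
split.
  exists 2%N; split=> // k; rewrite nads_comp_system ?iter_shift_cst//.
  by apply/eqP => /(congr1 odd); rewrite oddM.
rewrite nads_orb_cst => -[|n] _ [x [->|->] <-]; by [left | right].
Qed.

Lemma nads_orb_cst_disjoint :
  nads_orb system (fun=> false) `&` nads_orb system (fun=> true) = set0.
Proof.
apply/seteqP; split=> // x; rewrite !nads_orb_cst.
by move=> [[]->] []/(congr1 (@^~ 1%N)).
Qed.

End Shift.

Theorem mainTheorem1 (R : realType) :
  exists X : metricType R,
    isolated [set: X] = set0 /\
    exists f : nat -> X -> X,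
      (forall n : nat, continuous (f n)) /\
      nads_finitely_generated f /\
      ~ nads_periodic f /\
      nads_transitive f /\
      closure (nads_Per f) = [set: X] /\
      exists x y : X,
        nads_invariant_periodic f x /\
        nads_invariant_periodic f y /\
        nads_orb f x `&` nads_orb f y = set0.
Proof.
exists (stream R); split; first exact: isolated_stream.
exists (@system R); split; first exact: continuous_system.
split; first exact: finitely_generated_system.
split; first exact: not_periodic_system.
split; first exact: nads_transitive_system.
split; first exact: dense_Per_system.
exists (fun=> false), (fun=> true).
split; first exact: cst_invariant_periodic.
split; first exact: cst_invariant_periodic.
exact: nads_orb_cst_disjoint.
Qed.
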